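(* Let $\{\gamma_k\}_{k=0}^{\infty}$ be a sequence of non-negative real numbers which is a non-trivial Legendre multiplier sequence. Then $\gamma_k \le \gamma_{k+1}$ for all $k \ge 0$. *)

(* Defs.v *)
From HB Require Import structures.
From mathcomp Require Import all_boot all_order all_algebra.
From mathcomp Require Import reals.
From mathcomp Require Import complex.
Set Implicit Arguments. Unset Strict Implicit. Unset Printing Implicit Defensive.
Import Order.TTheory GRing.Theory Num.Theory.
Local Open Scope ring_scope.

(* Legendre polynomials via Bonnet's recurrence:
   P_0 = 1, P_1 = X, (n+2) P_{n+2} = (2n+3) X P_{n+1} - (n+1) P_n. *)
Fixpoint legendre_pair (R : fieldType) (n : nat) : {poly R} * {poly R} :=
  match n with
  | 0 => (1, 'X)
  | m.+1 =>
      let (p, q) := legendre_pair R m in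
      (q, (m.+2)%:R^-1 *: ((2 * m + 3)%:R *: ('X * q) - (m.+1)%:R *: p))
  end.

Definition legendreP (R : fieldType) (n : nat) : {poly R} :=
  (legendre_pair R n).1.

(* A real polynomial has only real zeros if it is the zero polynomial
   (standard convention) or every complex zero of it is real. *)
Definition only_real_zeros (R : realType) (p : {poly R}) : Prop :=
  p = 0 \/ forall z : R[i], root (map_poly (real_complex R) p) z -> Im z = 0.

Definition legendre_multiplier_sequence (R : realType) (gamma : nat -> R) : Prop :=
  forall (n : nat) (a : nat -> R),
    only_real_zeros (\sum_(k < n.+1) a k *: legendreP R k) ->
    only_real_zeros (\sum_(k < n.+1) (gamma k * a k) *: legendreP R k).

Definition trivial_sequence (R : realType) (gamma : nat -> R) : Prop :=
  exists i j : nat, forall k, k != i -> k != j -> gamma k = 0.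

(* Main.v *)
(** Write M_n for the monic Legendre polynomials, X M_n = M_{n+1} + b_n M_{n-1}
    with b_n > 0 for n > 0, and T for the linear operator T M_n = g_n M_n, which
    preserves real-rootedness. Newton's inequality for the three top
    coefficients of T((X + s)^n), when g_n > 0, gives at s = 0 that
    g_{n-2} <= g_n, and as s grows that g_{n-2} g_n <= g_{n-1}^2; hence
    g_{n-2} <= g_{n-1} whenever g_n > 0.

    It remains to see that positivity propagates upwards. If g_n > 0 and
    g_{n-1} = 0, the sum of the squares of the roots of T p is the same for all
    monic real-rooted p of degree n, so the coefficients of T p are bounded;
    applied to p = X^j (X + s)^(n-j) with s large this forces g_j = 0 for
    j < n. So if positivity stopped at g_m, non-triviality would give
    g_{m-2} > 0. Then take p = X^m (X^2 - b^2) with b^2 slightly larger than the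
    value for which p has no M_m component: the M_m and M_{m-2} components of p
    are both negative, the former arbitrarily small, and T p violates Newton's
    inequality. *)
Require Import Defs.
From HB Require Import structures.
From mathcomp Require Import all_boot all_order all_algebra.
From mathcomp Require Import reals.
From mathcomp Require Import complex.
From mathcomp Require Import ring lra zify.
Import Order.TTheory GRing.Theory Num.Theory.
Local Open Scope ring_scope.

(** * Real-rooted polynomials: Newton's inequality and coefficient bounds *)

Section RealRooted.
Set Implicit Arguments.
Unset Strict Implicit.
Unset Printing Implicit Defensive.
Variable R : realType.
Implicit Types (p q f : {poly R}) (rs : seq R).

Lemma only_real_zerosM p q :
  only_real_zeros p -> only_real_zeros q -> only_real_zeros (p * q).
Proof.
move=> [-> _|hp [->|hq]]; [by left; rewrite mul0r|by left; rewrite mulr0|right=> z].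
by rewrite rmorphM rootM => /orP[/hp|/hq].
Qed.

Lemma only_real_zeros_XaddC (c : R) : only_real_zeros ('X + c%:P).
Proof.
right=> z; rewrite rmorphD /= map_polyX map_polyC /= rootE !hornerE.
rewrite addr_eq0 => /eqP ->; apply/Creal_ImP.
by rewrite rpredN; apply/Creal_ImP; rewrite -complexIm.
Qed.

Lemma only_real_zeros_exp p n : only_real_zeros p -> only_real_zeros (p ^+ n).
Proof.
move=> hp; elim: n => [|n IH]; last by rewrite exprS; apply: only_real_zerosM.
by right=> z; rewrite expr0 rmorph1 (negPf (root1 _)).
Qed.

(** Over [R[i]] the polynomial splits with real roots only, and the factorization descends because
    [map_poly] is injective. *)
Lemma only_real_zeros_split f n :
  only_real_zeros f -> f`_n != 0 -> (size f <= n.+1)%N ->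
  exists2 rs, size rs = n & f = f`_n *: \prod_(r <- rs) ('X - r%:P).
Proof.
move=> hf fn0 sf.
have f0 : f != 0 by apply: contraNneq fn0 => ->; rewrite coef0.
have sfn : size f = n.+1.
  apply/eqP; rewrite eqn_leq sf /= ltnNge.
  by apply: contraNN fn0 => /(nth_default 0) ->.
have lf : lead_coef f = f`_n by rewrite lead_coefE sfn.
case: hf => [f00|hf]; first by rewrite f00 eqxx in f0.
have [zs hz] := closed_field_poly_normal (map_poly (real_complex R) f).
rewrite lead_coef_map lf in hz.
have c0 : real_complex R f`_n != 0 by rewrite fmorph_eq0.
have zr z : z \in zs -> z = real_complex R (complex.Re z).
  move=> zin; have /Creal_ImP/RRe_real -> // : 'Im z = 0.
  by apply: hf; rewrite hz rootZ // root_prod_XsubC.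
have E : f = f`_n *: \prod_(r <- [seq complex.Re z | z <- zs]) ('X - r%:P).
  apply: (@map_poly_inj _ _ (real_complex R)).
  rewrite hz map_polyZ /= rmorph_prod /= big_map; congr (_ *: _).
  apply: eq_big_seq => z /zr {1}->.
  by rewrite rmorphB /= map_polyX map_polyC.
exists [seq complex.Re z | z <- zs] => //.
move/(congr1 (fun p : {poly R} => size p)): E.
by rewrite size_scale // size_prod_XsubC sfn => -[].
Qed.

(* The factor 'X^2 makes the two coefficients below the leading one exist
   whatever the number of roots. *)
Lemma top_coefs_prod_XsubC rs (q := 'X^2 * \prod_(r <- rs) ('X - r%:P)) :
  [/\ q`_(size rs).+2 = 1, q`_(size rs).+1 = - \sum_(r <- rs) r
    & 2 * q`_(size rs) = (\sum_(r <- rs) r) ^+ 2 - \sum_(r <- rs) r ^+ 2].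
Proof.
rewrite {}/q; elim: rs => [|r rs [h2 h1 h0]] /=.
  by rewrite !big_nil mulr1 !coefXn /=; split; ring.
rewrite !big_cons; set q := \prod_(j <- rs) _ in h2 h1 h0 *.
have -> : 'X^2 * (('X - r%:P) * q) = 'X * ('X^2 * q) - r *: ('X^2 * q).
  by rewrite -mul_polyC; ring.
have sq : ('X^2 * q)`_(size rs).+3 = 0.
  by apply: nth_default; rewrite size_monicM ?monicXn ?monic_neq0 ?monic_prod_XsubC //
    size_polyXn size_prod_XsubC /=; case: (size rs).
rewrite !coefB !coefZ !coefXM /= h2 h1 sq; split; first by ring.
  by ring.
by rewrite mulrBr h0; ring.
Qed.

(** Cauchy-Schwarz: [h] expands the sum of [(r - t) ^+ 2], and [t] is then set to the mean. *)
Lemma sqr_sum_le rs :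
  (\sum_(r <- rs) r) ^+ 2 <= (size rs)%:R * \sum_(r <- rs) r ^+ 2.
Proof.
have h t : 0 <= (\sum_(r <- rs) r ^+ 2) - 2 * t * (\sum_(r <- rs) r)
               + (size rs)%:R * t ^+ 2.
  elim: rs => [|r rs IH] /=; first by rewrite !big_nil; lra.
  by rewrite !big_cons -natr1; have := sqr_ge0 (r - t); nra.
case: rs h => [|r rs] h; first by rewrite !big_nil; lra.
set S := \sum_(r <- _) r; set n := (size _)%:R : R.
have n0 : 0 < n by rewrite ltr0n.
have := h (S / n); rewrite -/S -/n.
set Q := \sum_(r <- _) _ ^+ 2.
have -> : Q - 2 * (S / n) * S + n * (S / n) ^+ 2 = (n * Q - S ^+ 2) / n.
  by field; rewrite gt_eqF.
by rewrite pmulr_lge0 ?invr_gt0 // subr_ge0.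
Qed.

(** In terms of the sum S of the roots and the sum Q of their squares, this is S^2 <= (n + 2) Q
    times the squared leading coefficient. *)
Lemma newton_top f n :
  only_real_zeros f -> (size f <= n.+3)%N -> f`_n.+2 != 0 ->
  2 * n.+2%:R * f`_n.+2 * f`_n <= n.+1%:R * f`_n.+1 ^+ 2.
Proof.
move=> hf sf f0; have [rs srs ->] := only_real_zeros_split hf f0 sf.
have [] := top_coefs_prod_XsubC rs; rewrite srs !coefXnM /= !subSS !subn0.
set q := \prod_(r <- rs) _; rewrite !coefZ => -> -> h.
have := sqr_sum_le rs; rewrite srs.
set S := \sum_(r <- _) r in h *; set Q := \sum_(r <- _) _ ^+ 2 in h *.
rewrite -[n.+2%:R]natr1; set c := f`_n.+2; set k := n.+1%:R => hS.
have c2 : 0 <= c ^+ 2 by apply: sqr_ge0.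
have -> : 2 * (k + 1) * (c * 1) * (c * q`_n) = c ^+ 2 * ((k + 1) * (S ^+ 2 - Q)).
  by rewrite -h; ring.
have -> : k * (c * - S) ^+ 2 = c ^+ 2 * (k * S ^+ 2) by ring.
by apply: ler_wpM2l => //; lra.
Qed.

(** Each factor ['X - r%:P] multiplies a bound on the coefficients by at most 1 + B. *)
Lemma coef_prod_XsubC_le rs (B : R) i :
  0 <= B -> (forall r, r \in rs -> `|r| <= B) ->
  `|(\prod_(r <- rs) ('X - r%:P))`_i| <= (1 + B) ^+ size rs.
Proof.
move=> B0; elim: rs i => [|r rs IH] i hB.
  by rewrite big_nil coef1 expr0; case: (i == 0%N); rewrite /= ?normr1 ?normr0.
have {}IH j := IH j (fun r' h => hB r' (mem_behead (s := r :: rs) h)).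
have hr : `|r| <= B by apply: hB; rewrite mem_head.
rewrite big_cons mulrBl mul_polyC coefB coefZ coefXM exprS mulrDl mul1r.
apply: le_trans (ler_normB _ _) _; apply: lerD.
  by case: (i == 0%N); rewrite ?normr0 ?IH // exprn_ge0 // addr_ge0.
by rewrite normrM ler_pM.
Qed.

(* With vanishing second coefficient, [f`_n / f`_n.+2] is minus half the sum of
   the squares of the roots, which therefore bounds every root. *)
Lemma coef_bound_of_top f n i :
  only_real_zeros f -> (size f <= n.+3)%N -> f`_n.+2 != 0 -> f`_n.+1 = 0 ->
  `|f`_i| <= `|f`_n.+2| * (2 - 2 * (f`_n / f`_n.+2)) ^+ n.+2.
Proof.
move=> hf sf f0 f1; have [rs srs E] := only_real_zeros_split hf f0 sf.
have [] := top_coefs_prod_XsubC rs; rewrite srs !coefXnM /= !subSS !subn0.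
set q := \prod_(r <- rs) _ in E * => h2 h1 h0.
have q1 : q`_n.+1 = 0.
  by move: f1; rewrite E coefZ => /eqP; rewrite mulf_eq0 (negPf f0) => /eqP.
have qn : f`_n / f`_n.+2 = q`_n by rewrite {1}E coefZ mulrC mulKf.
rewrite qn {1}E coefZ normrM; apply: ler_wpM2l => //.
have hQ : - 2 * q`_n = \sum_(r <- rs) r ^+ 2.
  by move: h0; rewrite -[\sum_(r <- rs) r]opprK -h1 q1; lra.
have Q0 : 0 <= \sum_(r <- rs) r ^+ 2 by apply: sumr_ge0 => r _; apply: sqr_ge0.
(* The root bound is B = 1 + Q, with Q the sum of the squared roots: it works since |r| <= 1 +
   r^2. *)
have -> : 2 - 2 * q`_n = 1 + (1 - 2 * q`_n) by ring.
rewrite -srs; apply: coef_prod_XsubC_le; first by lra.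
move=> r rin; have : r ^+ 2 <= \sum_(r <- rs) r ^+ 2.
  by rewrite (big_rem r) //= lerDl sumr_ge0 // => x _; apply: sqr_ge0.
by rewrite -hQ -real_normK ?num_real //; have := sqr_ge0 (`|r| - 1); nra.
Qed.

End RealRooted.

(** * Monic families with a symmetric three-term recurrence *)

Section MonicFamily.
Set Implicit Arguments.
Unset Strict Implicit.
Unset Printing Implicit Defensive.
Variables (R : realType) (beta : nat -> R).
Implicit Types (p : {poly R}) (n k N : nat).

Fixpoint monic_family n : {poly R} :=
  match n with
  | 0 => 1
  | k.+1 => match k with
            | 0 => 'X
            | m.+1 => 'X * monic_family k - beta k *: monic_family m
            end
  end.
Local Notation M := monic_family.

(* [Xcoef n k] is the coefficient of [M k] in the expansion of ['X^n]. *)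
Fixpoint Xcoef n k : R :=
  match n with
  | 0 => (k == 0%N)%:R
  | m.+1 => (if k is l.+1 then Xcoef m l else 0) + beta k.+1 * Xcoef m k.+1
  end.

Lemma monic_familySS n : M n.+2 = 'X * M n.+1 - beta n.+1 *: M n.
Proof. by []. Qed.

Lemma mulX_monic_family k :
  'X * M k = M k.+1 + (if k is l.+1 then beta k *: M l else 0).
Proof. by case: k => [|k]; rewrite ?monic_familySS ?subrK //= mulr1 addr0. Qed.

Lemma monic_family_ind (P : nat -> Prop) :
  P 0%N -> P 1%N -> (forall n, P n -> P n.+1 -> P n.+2) -> forall n, P n.
Proof.
move=> h0 h1 hS n; suff : P n /\ P n.+1 by case.
by elim: n => [|n [IH1 IH2]]; split=> //; apply: hS.
Qed.

Lemma coef_monic_family_gt n i : (n < i)%N -> (M n)`_i = 0.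
Proof.
elim/monic_family_ind: n i => [||n IH0 IH1] i hi.
- by rewrite coef1; case: i hi.
- by rewrite coefX; case: i hi => [|[]].
- case: i hi => // i hi; rewrite monic_familySS coefB coefZ coefXM /= IH1 // IH0; lia || ring.
Qed.

Lemma coef_monic_family_lead n : (M n)`_n = 1.
Proof.
elim/monic_family_ind: n => [||n _ IH]; rewrite ?coef1 ?coefX //.
by rewrite monic_familySS coefB coefZ coefXM /= IH coef_monic_family_gt // mulr0 subr0.
Qed.

Lemma coef_monic_familyS n : (M n.+1)`_n = 0.
Proof.
elim: n => [|n IH]; first by rewrite coefX.
by rewrite monic_familySS coefB coefZ coefXM /= IH coef_monic_family_gt // mulr0 subr0.
Qed.

Lemma Xcoef_gt n k : (n < k)%N -> Xcoef n k = 0.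
Proof.
elim: n k => [|n IH] [|k] //= hk.
by rewrite !IH ?mulr0 ?addr0 //; lia.
Qed.

Lemma Xcoef_diag n : Xcoef n n = 1.
Proof. by elim: n => //= n ->; rewrite Xcoef_gt ?mulr0 ?addr0 //; lia. Qed.

(** Multiplication by ['X] sends [M k] to its two neighbours only, so each step flips parity. *)
Lemma Xcoef_odd n k : odd (n + k) -> Xcoef n k = 0.
Proof.
elim: n k => [|n IH] [|k] //= h.
  by rewrite IH ?mulr0 ?addr0 //; lia.
by rewrite !IH ?mulr0 ?addr0 //; lia.
Qed.

(** Iterated, this makes [Xcoef n.+2 n] the sum of [beta 1] up to [beta n.+1]. *)
Lemma XcoefSS n : Xcoef n.+3 n.+1 = Xcoef n.+2 n + beta n.+2.
Proof.
have -> : Xcoef n.+3 n.+1 = Xcoef n.+2 n + beta n.+2 * Xcoef n.+2 n.+2 by [].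
by rewrite Xcoef_diag mulr1.
Qed.

Lemma coef_monic_familySS n : (M n.+2)`_n = - Xcoef n.+2 n.
Proof.
elim: n => [|n IH].
  by rewrite monic_familySS coefB coefZ coefXM /= coef1 /=; ring.
rewrite monic_familySS coefB coefZ coefXM [_ == _]/= [_.-1]/= IH.
by rewrite coef_monic_family_lead (XcoefSS n) mulr1 (opprD (Xcoef _ _)).
Qed.

Lemma polyXn_expansion n N : (n < N)%N -> 'X^n = \sum_(k < N) Xcoef n k *: M k.
Proof.
elim: n N => [|n IH] [//|N] hn.
  rewrite big_ord_recl big1 ?addr0 /= ?scale1r ?expr0 // => i _.
  by rewrite scale0r.
rewrite exprS (IH N) // mulr_sumr.
under eq_bigr => k _ do rewrite -scalerAr mulX_monic_family scalerDr.
rewrite big_split /= .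
under [RHS]eq_bigr => k _ do rewrite scalerDl.
(* Upward shifts give the first summand of [Xcoef], downward ones the [beta] summand; the two extra
   top terms on the right vanish since n < N. *)
rewrite [RHS]big_split /=; congr (_ + _).
  by rewrite [RHS]big_ord_recl scale0r add0r; apply: eq_bigr.
case: N hn => // N hn.
rewrite big_ord_recl scaler0 add0r [RHS]big_ord_recr [X in _ = X + _]big_ord_recr /=.
rewrite [Xcoef n N.+2]Xcoef_gt ?[Xcoef n N.+1]Xcoef_gt; [|lia..].
rewrite !mulr0 !scale0r !addr0; apply: eq_bigr => k _.
by rewrite scalerA mulrC.
Qed.

Definition family_coef N p k := \sum_(i < N.+1) p`_i * Xcoef i k.

Lemma family_expansion N p : (size p <= N.+1)%N ->
  p = \sum_(k < N.+1) family_coef N p k *: M k.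
Proof.
move=> sp; rewrite [LHS](_ : _ = \sum_(i < N.+1) p`_i *: 'X^i); last first.
  by rewrite -poly_def; apply/polyP => i; rewrite coef_poly; case: ltnP => // h;
     rewrite nth_default // (leq_trans sp).
under eq_bigr => i _ do rewrite (polyXn_expansion (ltn_ord i)) scaler_sumr.
rewrite exchange_big /=; apply: eq_bigr => k _.
by rewrite /family_coef scaler_suml; apply: eq_bigr => i _; rewrite scalerA.
Qed.

Lemma family_coef_top N p : family_coef N p N = p`_N.
Proof.
rewrite /family_coef big_ord_recr /= Xcoef_diag mulr1 big1 ?add0r // => i _.
by rewrite Xcoef_gt ?mulr0.
Qed.

Lemma family_coef_top1 N p : family_coef N.+1 p N = p`_N.
Proof.
rewrite /family_coef 2!big_ord_recr /= -/(Xcoef N.+1 N) Xcoef_diag mulr1.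
rewrite (@Xcoef_odd N.+1); last by lia.
rewrite big1 ?add0r ?mulr0 ?addr0 // => i _.
by rewrite Xcoef_gt ?mulr0.
Qed.

(** Powers below N do not reach [M N], and ['X^N.+1] has the wrong parity. *)
Lemma family_coef_top2 N p : family_coef N.+2 p N = p`_N + p`_N.+2 * Xcoef N.+2 N.
Proof.
rewrite /family_coef 3!big_ord_recr /= -/(Xcoef N.+1 N) -/(Xcoef N.+2 N) Xcoef_diag mulr1.
rewrite (@Xcoef_odd N.+1); last by lia.
rewrite big1 ?add0r ?mulr0 ?addr0 // => i _.
by rewrite Xcoef_gt ?mulr0.
Qed.

Hypothesis beta_gt0 : forall n, 0 < beta n.+1.

Lemma Xcoef_ge0 n k : 0 <= Xcoef n k.
Proof.
elim: n k => [|n IH] k /=; first exact: ler0n.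
by apply: addr_ge0; [case: k|apply: mulr_ge0 => //; apply: ltW].
Qed.

Lemma Xcoef2_gt0 n : 0 < Xcoef n.+2 n.
Proof.
elim: n => [|n IH]; last by rewrite XcoefSS addr_gt0.
by rewrite /= add0r mulr0 addr0 mulr1.
Qed.

(** Induction: raising n adds [beta n.+2 * Xcoef n.+4 n.+2] on the left and more on the right, as
    [Xcoef k.+2 k] increases with k. Hence, once b^2 is at least [Xcoef n.+4 n.+2], the [M n]
    component of X^(n+2) (X^2 - b^2) is negative. *)
Lemma Xcoef4_lt n : Xcoef n.+4 n < Xcoef n.+4 n.+2 * Xcoef n.+2 n.
Proof.
have inc k : Xcoef k.+2 k < Xcoef k.+3 k.+1 by rewrite XcoefSS ltrDl.
elim: n => [|n IH].
  have -> : Xcoef 4 0 = beta 1 * Xcoef 3 1 by rewrite -[RHS]add0r.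
  have -> : Xcoef 2 0 = beta 1 by rewrite /=; ring.
  by rewrite mulrC ltr_pM2r.
have -> : Xcoef n.+4.+1 n.+1 = Xcoef n.+4 n + beta n.+2 * Xcoef n.+4 n.+2 by [].
have := inc n.+2; have := XcoefSS n; have := Xcoef2_gt0 n.+1; nra.
Qed.

(** * The diagonal operator and the monotonicity of its multipliers *)

Section Multiplier.
Variable gamma : nat -> R.
Hypothesis gamma_ge0 : forall k, 0 <= gamma k.
Hypothesis gammaP : forall N (a : nat -> R),
  only_real_zeros (\sum_(k < N.+1) a k *: M k) ->
  only_real_zeros (\sum_(k < N.+1) (gamma k * a k) *: M k).

(** The operator T on polynomials of degree at most [N], cut off so as to match [gammaP]. *)
Definition multiplier N p := \sum_(k < N.+1) (gamma k * family_coef N p k) *: M k.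

Lemma multiplier_real_zeros N p : (size p <= N.+1)%N ->
  only_real_zeros p -> only_real_zeros (multiplier N p).
Proof. by move=> sp hp; apply: gammaP; rewrite -family_expansion. Qed.

Lemma coef_multiplier N p i :
  (multiplier N p)`_i = \sum_(k < N.+1) gamma k * family_coef N p k * (M k)`_i.
Proof. by rewrite coef_sum; apply: eq_bigr => k _; rewrite coefZ. Qed.

Lemma size_multiplier N p : (size (multiplier N p) <= N.+1)%N.
Proof.
apply/leq_sizeP => j hj; rewrite coef_multiplier big1 // => k _.
by rewrite coef_monic_family_gt ?mulr0 // (leq_trans _ hj).
Qed.

(* The shift [m >= n] serves the case where [gamma] vanishes above [n]. *)
Lemma coef_multiplier_top m n p :
  (n <= m)%N -> (forall k, (n < k <= m)%N -> gamma k = 0) ->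
  (multiplier m p)`_n = gamma n * family_coef m p n.
Proof.
move=> nm g0; rewrite coef_multiplier (bigD1 (Ordinal (nm : n < m.+1)%N)) //=.
rewrite coef_monic_family_lead mulr1 big1 ?addr0 // => k kn.
have [nk|nk|nk] := ltngtP n k; last by case/eqP: kn; apply: val_inj.
  by rewrite g0 ?mul0r // nk -ltnS ltn_ord.
by rewrite coef_monic_family_gt ?mulr0.
Qed.

Lemma coef_multiplier_top1 m n p :
  (n.+1 <= m)%N -> (forall k, (n.+1 < k <= m)%N -> gamma k = 0) ->
  (multiplier m p)`_n = gamma n * family_coef m p n.
Proof.
move=> nm g0; have nm' : (n < m.+1)%N by lia.
rewrite coef_multiplier (bigD1 (Ordinal nm')) //=.
rewrite coef_monic_family_lead mulr1 big1 ?addr0 // => k kn.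
have [nk|nk|nk] := ltngtP n k; last by case/eqP: kn; apply: val_inj.
  have [->|kn1] := eqVneq (k : nat) n.+1; first by rewrite coef_monic_familyS mulr0.
  by rewrite g0 ?mul0r //; have := ltn_ord k; lia.
by rewrite coef_monic_family_gt ?mulr0.
Qed.

(** Besides [M n], only [M n.+2] contributes, through its coefficient [- Xcoef n.+2 n]; [M n.+1]
    drops out by parity. *)
Lemma coef_multiplier_top2 m n p :
  (n.+2 <= m)%N -> (forall k, (n.+2 < k <= m)%N -> gamma k = 0) ->
  (multiplier m p)`_n = gamma n * family_coef m p n
    - gamma n.+2 * family_coef m p n.+2 * Xcoef n.+2 n.
Proof.
move=> nm g0; have nm' : (n < m.+1)%N by lia.
rewrite coef_multiplier (bigD1 (Ordinal nm')) //=.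
rewrite (bigD1 (Ordinal (nm : n.+2 < m.+1)%N)) /=; last by rewrite -val_eqE /=; lia.
rewrite coef_monic_family_lead mulr1 coef_monic_familySS big1 ?addr0 ?mulrN //.
move=> k /andP[kn kn2].
have [nk|nk|nk] := ltngtP n k; last by case/eqP: kn; apply: val_inj.
  have [->|kn1] := eqVneq (k : nat) n.+1; first by rewrite coef_monic_familyS mulr0.
  rewrite g0 ?mul0r //; have := ltn_ord k; move: kn2; rewrite -val_eqE /=; lia.
by rewrite coef_monic_family_gt ?mulr0.
Qed.

Lemma coef_XaddC_exp (s : R) n i :
  (('X + s%:P) ^+ n)`_i = (s ^+ (n - i)) *+ 'C(n, i).
Proof.
rewrite addrC exprDn coef_sum.
under eq_bigr => k _ do rewrite -polyC_exp mul_polyC coefMn coefZ coefXn.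
have [hi|hi] := leqP i n; last first.
  rewrite bin_small // mulr0n big1 // => k _.
  by rewrite gtn_eqF ?mulr0 ?mul0rn //; have := ltn_ord k; lia.
rewrite (bigD1 (Ordinal (hi : i < n.+1)%N)) //= eqxx mulr1 big1 ?addr0 // => k.
by rewrite -val_eqE /= eq_sym => /negPf ->; rewrite mulr0 mul0rn.
Qed.

Lemma newton_multiplier n (s : R) : 0 < gamma n.+2 ->
  2 * n.+2%:R * gamma n.+2 *
    (gamma n * (s ^+ 2 *+ 'C(n.+2, 2) + Xcoef n.+2 n) - gamma n.+2 * Xcoef n.+2 n)
  <= n.+1%:R * (gamma n.+1 * (s *+ n.+2)) ^+ 2.
Proof.
move=> g0; set p := ('X + s%:P) ^+ n.+2.
have sp : (size p <= n.+3)%N.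
  by apply: leq_trans (size_poly_exp_leq _ _) _; rewrite size_XaddC mul1n.
have rp := multiplier_real_zeros sp (only_real_zeros_exp _ (only_real_zeros_XaddC s)).
have g k : (n.+2 < k <= n.+2)%N -> gamma k = 0 by lia.
have p2 : p`_n.+2 = 1 by rewrite coef_XaddC_exp subnn binn.
have p1 : p`_n.+1 = s *+ n.+2 by rewrite coef_XaddC_exp subSnn expr1 binSn.
have p0 : p`_n = s ^+ 2 *+ 'C(n.+2, 2).
  by rewrite coef_XaddC_exp -addn2 -(bin_sub (leq_addl n 2)) addKn addnK.
have f2 : (multiplier n.+2 p)`_n.+2 = gamma n.+2.
  by rewrite coef_multiplier_top // family_coef_top p2 mulr1.
have f1 : (multiplier n.+2 p)`_n.+1 = gamma n.+1 * (s *+ n.+2).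
  by rewrite coef_multiplier_top1 // family_coef_top1 p1.
have f0 : (multiplier n.+2 p)`_n = gamma n * (s ^+ 2 *+ 'C(n.+2, 2) + Xcoef n.+2 n)
    - gamma n.+2 * Xcoef n.+2 n.
  by rewrite coef_multiplier_top2 // family_coef_top2 family_coef_top p0 p2 !mulr1 mul1r.
have := newton_top rp (size_multiplier _ _); rewrite f2 f1 f0; apply.
by rewrite gt_eqF.
Qed.

Lemma multiplier_le n : 0 < gamma n.+2 -> gamma n <= gamma n.+1.
Proof.
move=> g2; have u0 := Xcoef2_gt0 n.
have h s := newton_multiplier s g2.
have n0 : (0 : R) < n.+2%:R by rewrite ltr0n.
have n1 : (0 : R) < n.+1%:R by rewrite ltr0n.
(* At s = 0 the right-hand side of Newton's inequality vanishes. *)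
have h02 : gamma n <= gamma n.+2.
  have := h 0; rewrite !mul0rn expr0n /= mul0rn mulr0 expr0n /= mulr0 add0r.
  have -> : 2 * n.+2%:R * gamma n.+2 * (gamma n * Xcoef n.+2 n - gamma n.+2 * Xcoef n.+2 n)
     = (2 * n.+2%:R * gamma n.+2 * Xcoef n.+2 n) * (gamma n - gamma n.+2) by ring.
  by rewrite pmulr_rle0 ?subr_le0 // !mulr_gt0.
rewrite leNgt; apply/negP => h10.
(* Under [h10] and [h02], the product is at least [gamma n ^+ 2], which exceeds
   [gamma n.+1 ^+ 2]. *)
have d0 : 0 < gamma n * gamma n.+2 - gamma n.+1 ^+ 2.
  by have := gamma_ge0 n.+1; nra.
have binE : 2 * ('C(n.+2, 2))%:R = n.+2%:R * n.+1%:R :> R.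
  rewrite -!natrM [X in X%:R](_ : _ = n.+2 * n.+1)%N // mulnC bin2 muln2.
  by rewrite -[RHS]odd_double_half oddM /= andNb add0n.
set d := _ - _ in d0; set u := Xcoef n.+2 n in h u0.
(* With s the square root of t, Newton's inequality is affine in t; a positive slope contradicts it
   for large t. *)
have key t : 0 <= t -> n.+2%:R * n.+1%:R * d * t <= 2 * gamma n.+2 ^+ 2 * u.
  move=> t0; have := h (Num.sqrt t).
  rewrite -(mulr_natr (Num.sqrt t)) -[_ *+ 'C(_, _)]mulr_natr 2!exprMn sqr_sqrtr //.
  have -> : 2 * n.+2%:R * gamma n.+2 * (gamma n * (t * 'C(n.+2, 2)%:R + u) - gamma n.+2 * u)
     = n.+2%:R * (gamma n.+2 * gamma n * t * (2 * 'C(n.+2, 2)%:R)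
        + 2 * gamma n.+2 * gamma n * u - 2 * gamma n.+2 ^+ 2 * u) by ring.
  rewrite binE.
  have -> : n.+1%:R * (gamma n.+1 ^+ 2 * (t * n.+2%:R ^+ 2)) =
     n.+2%:R * (n.+2%:R * n.+1%:R * t * gamma n.+1 ^+ 2) by ring.
  rewrite ler_pM2l // /d.
  by have : 0 <= gamma n.+2 * gamma n * u; [rewrite !mulr_ge0 // ltW|lra].
set c := n.+2%:R * n.+1%:R * d in key.
have c0 : 0 < c by rewrite !mulr_gt0.
have w0 : 0 < 2 * gamma n.+2 ^+ 2 * u by rewrite !mulr_gt0 ?exprn_gt0.
(* This t makes the left-hand side twice the positive bound. *)
have := key (2 * (2 * gamma n.+2 ^+ 2 * u) / c).
rewrite [c * _]mulrC divfK ?gt_eqF //; set w := _ * u in w0 *.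
by move=> /(_ (divr_ge0 (mulr_ge0 (ler0n _ 2) (ltW w0)) (ltW c0))); lra.
Qed.

Lemma multiplier_no_gap n : 0 < gamma n.+1 -> gamma n = 0 ->
  forall j, (j < n)%N -> gamma j = 0.
Proof.
case: n => // n g2 g1.
have g0 : gamma n = 0.
  by apply/eqP; rewrite eq_le gamma_ge0 -g1 multiplier_le.
(* Induction on the distance d down from [n.+2]: every multiplier strictly between j and [n.+2] is
   already zero, so coefficient j of T p sees only [M j] and [M n.+2]. *)
suff H d : forall j, (j + d = n.+2)%N -> (0 < d)%N -> gamma j = 0.
  by move=> j hj; apply: (H (n.+2 - j)%N); lia.
elim/ltn_ind: d => d IH j hj d0.
have [d1|d1] := leqP d 2.
  by have [->|->] : j = n.+1 \/ j = n by lia.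
apply/eqP; rewrite eq_le gamma_ge0 andbT leNgt; apply/negP => gj.
have gz k : (j < k < n.+2)%N -> gamma k = 0 by move=> hk; apply: (IH (n.+2 - k)%N); lia.
set u := Xcoef n.+2 n.
(* The first term is the bound of [coef_bound_of_top], where the coefficient ratio is -u; the second
   absorbs the contribution of [M n.+2]. *)
set B := gamma n.+2 * (2 + 2 * u) ^+ n.+2 + gamma n.+2 * `|(M n.+2)`_j|.
have B0 : 0 <= B.
  have u0 : 0 < u := Xcoef2_gt0 n.
  by rewrite addr_ge0 // mulr_ge0 // exprn_ge0 // addr_ge0 // mulr_ge0 // ltW.
(* Chosen so that [gamma j * s] equals [gamma j + B], exceeding B. *)
pose s := 1 + B / gamma j.
have s1 : 1 <= s by rewrite lerDl divr_ge0.
set p := 'X^j * ('X + s%:P) ^+ d.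
have pE i : p`_(j + i) = s ^+ (d - i) *+ 'C(d, i).
  by rewrite coefXnM ltnNge leq_addr /= addKn coef_XaddC_exp.
have sp : (size p <= n.+3)%N.
  rewrite (leq_trans (size_polyMleq _ _)) // size_polyXn.
  have := size_poly_exp_leq ('X + s%:P) d; rewrite size_XaddC; lia.
have rp : only_real_zeros p.
  apply: only_real_zerosM; apply: only_real_zeros_exp; last exact: only_real_zeros_XaddC.
  by rewrite -[X in only_real_zeros X]addr0 -polyC0; apply: only_real_zeros_XaddC.
have rf := multiplier_real_zeros sp rp.
have p2 : p`_n.+2 = 1 by rewrite -hj pE subnn binn.
have g k : (n.+2 < k <= n.+2)%N -> gamma k = 0 by lia.
set f := multiplier n.+2 p in rf.
have f2 : f`_n.+2 = gamma n.+2.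
  by rewrite coef_multiplier_top // family_coef_top p2 mulr1.
have f1 : f`_n.+1 = 0 by rewrite coef_multiplier_top1 // g1 mul0r.
have f0 : f`_n = - (gamma n.+2 * u).
  by rewrite coef_multiplier_top2 // g0 mul0r add0r family_coef_top p2 mulr1.
have fj : f`_j = gamma j * family_coef n.+2 p j + gamma n.+2 * (M n.+2)`_j.
  rewrite coef_multiplier big_ord_recr /= -/(M n.+2) family_coef_top p2 mulr1; congr (_ + _).
  have jn : (j < n.+2)%N by lia.
  rewrite (bigD1 (Ordinal jn)) //= coef_monic_family_lead mulr1 big1 ?addr0 // => k kj.
  have [jk|jk|jk] := ltngtP j k; last by case/eqP: kj; apply: val_inj.
    by rewrite gz ?mul0r // jk ltn_ord.
  by rewrite coef_monic_family_gt ?mulr0.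
(* The ['X^j] term alone gives s^d >= s, and all other terms are non-negative. *)
have a_ge : s <= family_coef n.+2 p j.
  have s0 : 0 <= s by lra.
  have jn : (j < n.+3)%N by lia.
  rewrite /family_coef (bigD1 (Ordinal jn)) //= Xcoef_diag mulr1.
  rewrite -[X in p`_X](addn0 j) pE subn0 bin0 mulr1n.
  apply: ler_wpDr; last by rewrite -[leLHS]expr1 ler_weXn2l.
  apply: sumr_ge0 => i _; apply: mulr_ge0 (Xcoef_ge0 _ _).
  rewrite coefXnM; case: ltnP => // _; rewrite coef_XaddC_exp.
  by rewrite mulrn_wge0 // exprn_ge0.
have := coef_bound_of_top j rf (size_multiplier _ _); rewrite f2 f1 f0 fj.
rewrite gt_eqF // => /(_ isT erefl).
rewrite mulNr [gamma n.+2 * u]mulrC mulfK ?gt_eqF // (gtr0_norm g2) mulrN opprK => hb.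
have : gamma j * s <= B.
  apply: le_trans (_ : gamma j * family_coef n.+2 p j <= _); first by rewrite ler_pM2l.
  rewrite -lerBlDr; apply: le_trans hb.
  rewrite -{1}[gamma n.+2](gtr0_norm g2) -normrM.
  have := ler_norm (gamma j * family_coef n.+2 p j).
  by have := lerB_normD (gamma j * family_coef n.+2 p j) (gamma n.+2 * (M n.+2)`_j); lra.
by rewrite mulrDr mulr1 mulrCA divff ?gt_eqF // mulr1; lra.
Qed.

Lemma multiplier_no_end n : 0 < gamma n -> 0 < gamma n.+2 ->
  gamma n.+3 = 0 -> gamma n.+4 = 0 -> False.
Proof.
move=> g0 g2 g3 g4.
have u0 := Xcoef2_gt0 n; have u2 := Xcoef2_gt0 n.+2.
have d0 : 0 < Xcoef n.+4 n.+2 * Xcoef n.+2 n - Xcoef n.+4 n.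
  by rewrite subr_gt0 Xcoef4_lt.
set u := Xcoef n.+2 n in u0 d0; set u' := Xcoef n.+4 n.+2 in u2 d0; set d := _ - _ in d0.
(* The [M n.+2] component of T p feeds [gamma n.+2 * e * u] into coefficient n; this e makes it
   cancel [gamma n * d], leaving [- gamma n * e * u]. *)
pose e := gamma n * d / (gamma n.+2 * u).
have e0 : 0 < e by rewrite divr_gt0 // mulr_gt0.
pose b := Num.sqrt (u' + e).
have b2 : b ^+ 2 = u' + e by rewrite sqr_sqrtr // addr_ge0 // ltW.
pose p : {poly R} := 'X^(n.+4) - (b ^+ 2) *: 'X^(n.+2).
have rp : only_real_zeros p.
  have -> : p = ('X + 0%:P) ^+ n.+2 * (('X + b%:P) * ('X + (- b)%:P)).
    by rewrite /p -mul_polyC polyC_exp polyCN addr0 -[n.+4]addn2 exprD; ring.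
  apply: only_real_zerosM; first by apply: only_real_zeros_exp; apply: only_real_zeros_XaddC.
  by apply: only_real_zerosM; apply: only_real_zeros_XaddC.
have sp : (size p <= n.+4.+1)%N.
  rewrite (leq_trans (size_polyD _ _)) // geq_max size_polyXn leqnn /= size_polyN.
  by rewrite (leq_trans (size_scale_leq _ _)) // size_polyXn; lia.
have rf := multiplier_real_zeros sp rp.
have aE k : family_coef n.+4 p k = Xcoef n.+4 k - b ^+ 2 * Xcoef n.+2 k.
  rewrite /family_coef; under eq_bigr => i _ do rewrite coefB coefZ !coefXn mulrBl -mulrA.
  rewrite sumrB -mulr_sumr; congr (_ - _ * _).
    rewrite (bigD1 (ord_max : 'I_n.+4.+1)) //= eqxx mul1r big1 ?addr0 // => i.
    by rewrite -val_eqE /= => /negPf ->; rewrite mul0r.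
  have n2 : (n.+2 < n.+4.+1)%N by lia.
  rewrite (bigD1 (Ordinal n2)) //= eqxx mul1r big1 ?addr0 // => i.
  by rewrite -val_eqE /= => /negPf ->; rewrite mul0r.
have gz k : (n.+2 < k <= n.+4)%N -> gamma k = 0.
  by move=> hk; have [->|->] : k = n.+3 \/ k = n.+4 by lia.
set f := multiplier n.+4 p in rf.
have f2 : f`_n.+2 = - (gamma n.+2 * e).
  by rewrite coef_multiplier_top ?aE ?b2 ?Xcoef_diag //; [rewrite -/u'; ring|lia].
have f1 : f`_n.+1 = 0.
  rewrite coef_multiplier_top1 //; last by lia.
  by rewrite aE !Xcoef_odd ?mulr0 ?subrr ?mulr0 //; lia.
have f0 : f`_n = gamma n.+2 * e * u - gamma n * (d + e * u).
  by rewrite coef_multiplier_top2 ?aE ?b2 ?Xcoef_diag -/u' -/u /d //; [ring|lia].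
have f00 : f`_n < 0.
  rewrite f0; have -> : gamma n.+2 * e * u = gamma n * d.
    by rewrite /e; field; rewrite !gt_eqF.
  by rewrite subr_lt0 ltr_pM2l // ltrDl mulr_gt0.
have f20 : f`_n.+2 < 0 by rewrite f2 oppr_lt0 mulr_gt0.
(* The two vanishing multipliers lower the degree to n + 2, so Newton's inequality applies there. *)
have sf : (size f <= n.+3)%N.
  apply/leq_sizeP => j hj; rewrite coef_multiplier big1 // => k _.
  have [hk|hk] := leqP k n.+2; first by rewrite coef_monic_family_gt ?mulr0 //; lia.
  by rewrite gz ?mul0r //; have := ltn_ord k; lia.
(* As coefficient n + 1 is zero, the two negative neighbours would need a non-positive product. *)
have := newton_top rf sf; rewrite lt_eqF // => /(_ isT).
rewrite f1 expr0n /= mulr0 -mulrA leNgt => /negP; apply.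
by rewrite pmulr_rgt0 ?(nmulr_rgt0 _ f20) // mulr_gt0 ?ltr0n.
Qed.

Lemma multiplier_gt0S k : ~ trivial_sequence gamma -> 0 < gamma k -> 0 < gamma k.+1.
Proof.
move=> nt gk; rewrite lt_neqAle gamma_ge0 andbT eq_sym; apply/eqP => gk1.
(* A positive value right after a zero would force [gamma k = 0], by [multiplier_le] for m = 0 and
   by [multiplier_no_gap] beyond. *)
have gtail m : gamma (k.+1 + m) = 0.
  elim: m => [|m IH]; first by rewrite addn0.
  apply/eqP; rewrite addnS eq_le gamma_ge0 andbT leNgt; apply/negP => gm.
  have /multiplier_no_gap /(_ IH k) gk0 := gm.
  case: m => [|m] in IH gm gk0 *.
    rewrite addn0 in gm; have := multiplier_le gm; rewrite gk1; lra.
  by rewrite gk0 ?ltxx // in gk; lia.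
have gt j : (k < j)%N -> gamma j = 0.
  by move=> hj; rewrite -(subnKC hj).
have pos j : gamma j != 0 -> 0 < gamma j by rewrite lt_neqAle eq_sym gamma_ge0 andbT.
(* If one of the two values preceding [gamma k] is zero or does not exist, at most two indices carry
   non-zero values, against non-triviality; otherwise [multiplier_no_end] applies. *)
case: k => [|k] in gk gk1 gtail gt *.
  by apply: nt; exists 0%N, 0%N => j j0 _; apply: gt; lia.
have [g0|/pos gk0] := eqVneq (gamma k) 0.
  apply: nt; exists k.+1, k => j jk jk1.
  have [jk2|jk2] := ltnP j k; last by apply: gt; lia.
  exact: multiplier_no_gap jk2.
case: k => [|k] in gk gk1 gtail gt gk0 *.
  by apply: nt; exists 0%N, 1%N => j j0 j1; apply: gt; lia.
have [g0|/pos gk2] := eqVneq (gamma k) 0.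
  apply: nt; exists k.+2, k.+1 => j jk jk1.
  have [jk2|jk2] := ltnP j k; first exact: multiplier_no_gap jk2.
  have [->//|jk3] := eqVneq j k.
  by apply: gt; lia.
by apply: (@multiplier_no_end k) => //; apply: gt.
Qed.

Lemma multiplier_nondecreasing k : ~ trivial_sequence gamma -> gamma k <= gamma k.+1.
Proof.
move=> nt; have := gamma_ge0 k; rewrite le_eqVlt => /orP[/eqP <-//|gk].
(* Positivity is propagated from k to k + 2. *)
by apply: multiplier_le; do 2 apply: multiplier_gt0S => //.
Qed.

End Multiplier.
End MonicFamily.

(** * Legendre polynomials as a rescaled monic family *)

Lemma legendrePSS (R : fieldType) n :
  legendreP R n.+2 = n.+2%:R^-1 *:
    ((2 * n + 3)%:R *: ('X * legendreP R n.+1) - n.+1%:R *: legendreP R n).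
Proof. by rewrite /legendreP /=; case: (legendre_pair R n). Qed.

(** The recurrence coefficient n^2 / (4 n^2 - 1) of the monic Legendre polynomials. *)
Definition legendre_beta (R : realType) (n : nat) : R :=
  n%:R ^+ 2 / ((2 * n)%:R ^+ 2 - 1).

(** The leading coefficient of P_n, as the product of the ratios (2i + 1) / (i + 1) read off
    Bonnet's recurrence. *)
Definition legendre_lead (R : realType) (n : nat) : R :=
  \prod_(i < n) ((2 * i + 1)%:R / i.+1%:R).

Lemma legendre_beta_gt0 (R : realType) n : 0 < legendre_beta R n.+1.
Proof.
rewrite /legendre_beta divr_gt0 ?exprn_gt0 ?ltr0n // subr_gt0.
by rewrite expr_gt1 ?ler0n // ltr1n; lia.
Qed.

Lemma legendre_lead_neq0 (R : realType) n : legendre_lead R n != 0.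
Proof.
rewrite gt_eqF //; apply: prodr_gt0 => i _.
by rewrite divr_gt0 // ltr0n; lia.
Qed.

Lemma legendreP_monic (R : realType) n :
  legendreP R n = legendre_lead R n *: monic_family (legendre_beta R) n.
Proof.
elim/monic_family_ind: n => [||n IH0 IH1].
- by rewrite /legendre_lead big_ord0 scale1r.
- by rewrite /legendre_lead big_ord1 /= divff ?oner_neq0 // scale1r.
rewrite legendrePSS IH0 IH1 monic_familySS /legendre_lead !big_ord_recr /=.
set l := \prod_(i < n) _.
rewrite -scalerAr !scalerBr !scalerA; congr (_ *: _ - _ *: _).
  rewrite (_ : 2 * n + 3 = 2 * n.+1 + 1)%N; last by lia.
  by rewrite mulrC [_^-1 * _]mulrC.
rewrite /legendre_beta !(natrM, natrD, =^~ natr1).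
have n0 : 0 <= n%:R :> R := ler0n _ _.
set x := n%:R in n0 *.
by field; apply/and3P; split; rewrite gt_eqF //; nra.
Qed.

Theorem theorem3p6 (R : realType) (gamma : nat -> R) :
  (forall k, 0 <= gamma k) ->
  legendre_multiplier_sequence gamma ->
  ~ trivial_sequence gamma ->
  forall k : nat, gamma k <= gamma k.+1.
Proof.
move=> g0 gP nt k.
apply: (multiplier_nondecreasing (@legendre_beta_gt0 R)) => // N a ha.
(* Rescaling the basis only divides the coordinates by [legendre_lead], which commutes with
   multiplication by [gamma]. *)
have E (c : nat -> R) : \sum_(k < N.+1) c k *: monic_family (legendre_beta R) k
    = \sum_(k < N.+1) (c k / legendre_lead R k) *: legendreP R k.
  apply: eq_bigr => i _.
  by rewrite legendreP_monic scalerA divfK // legendre_lead_neq0.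
move: ha; rewrite E (E (fun k => gamma k * a k)) => ha.
under eq_bigr => i _ do rewrite -mulrA.
exact: (gP N (fun k => a k / legendre_lead R k)).
Qed.
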